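(* Let $a<b$ be real numbers and let $f:[a,b]\to\mathbb{R}$ be a function such that $f'$ is absolutely continuous on $[a,b]$ and $f''\in L_1[a,b]$. Let $q>1$ and let $p$ satisfy $\frac1p+\frac1q=1$. If $|f''|^q$ is convex on $[a,b]$, then for all $x\in\left[a,\frac{a+b}{2}\right]$, $$\left|\frac{1}{b-a}\int_a^b f(t)\,dt-\frac12\left[f(x)+f(a+b-x)\right]+\frac12\left(x-\frac{3a+b}{4}\right)\left[f'(x)-f'(a+b-x)\right]\right|$$ $$\le \frac{1}{2^{1+\frac1q}(b-a)(2p+1)^{\frac1p}}\Big[(x-a)^3\left(|f''(a)|^q+|f''(x)|^q\right)^{\frac1q}+\frac{(a+b-2x)^3}{4}\left(|f''(x)|^q+|f''(a+b-x)|^q\right)^{\frac1q}$$ $$+(x-a)^3\left(|f''(a+b-x)|^q+|f''(b)|^q\right)^{\frac1q}\Big].$$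
   Context: The derivatives $f'$ and $f''$ are the first and second derivatives of $f$ on $[a,b]$ (one-sided at the endpoints); the hypothesis that $|f''|^q$ is convex on $[a,b]$ is understood to include that $f''$ is defined on $[a,b]$. $L_1[a,b]$ is the space of Lebesgue integrable functions on $[a,b]$. *)

(* Defs.v *)
From mathcomp Require Export all_boot all_order all_algebra.
From mathcomp Require Export all_classical all_reals all_analysis.

Set Implicit Arguments.
Unset Strict Implicit.
Unset Printing Implicit Defensive.

Import Order.TTheory GRing.Theory Num.Theory.
Import numFieldNormedType.Exports.

Local Open Scope classical_set_scope.
Local Open Scope ring_scope.

(* A function on [a, b] is represented by a total function on R of which only
   the values on [a, b] matter.  Differentiation is therefore relative to a set
   A: the difference quotient is taken along points of A only, so that for
   A = [a, b] the derivatives at a and b are the one-sided ones. *)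
Definition derivable_within (R : realType) (A : set R) (f : R -> R) (x : R) :
    Prop :=
  cvg ((f y - f x) / (y - x) @[y --> within A x^']).

Definition derive_within (R : realType) (A : set R) (f : R -> R) (x : R) : R :=
  lim ((f y - f x) / (y - x) @[y --> within A x^']).

Definition absolutely_continuous (R : realType) (a b : R) (g : R -> R) : Prop :=
  forall e : R, 0 < e -> exists2 d : R, 0 < d &
    forall (n : nat) (u v : 'I_n -> R),
      (forall i, [/\ a <= u i, u i < v i & v i <= b]) ->
      trivIset [set: 'I_n] (fun i => `]u i, v i[%classic) ->
      \sum_(i < n) (v i - u i) < d ->
      \sum_(i < n) `|g (v i) - g (u i)| < e.

(* Main.v *)
Require Import Defs.
From mathcomp Require Import ring lra.

Set Implicit Arguments.
Unset Strict Implicit.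
Unset Printing Implicit Defensive.

Import Order.TTheory GRing.Theory Num.Theory.
Import numFieldNormedType.Exports.

Local Open Scope classical_set_scope.
Local Open Scope ring_scope.

(** The theorem is Hoelder's inequality for the identity
    2 (b - a) E(x) = int_a^b K(t) f''(t) dt, where E(x) is the quantity inside
    the absolute value and the kernel K is (t - m)^2 with a centre m that
    depends on the piece: m = a on [a, x], m = (a + b) / 2 on [x, a + b - x]
    and m = b on [a + b - x, b].  On a piece [c, d], convexity puts |f''|^q
    below its chord, whose integral is (d - c) (|f''(c)|^q + |f''(d)|^q) / 2,
    and |t - m|^(2p) integrates in closed form; the three products of a p-th
    and a q-th root are the three terms of the bound.

    The proof never integrates f''.  Integrating by parts twice shows that
    (t - m)^2 f'' has the explicit primitive
      G_m(t) = (t - m)^2 f'(t) - 2 (t - m) f(t) + 2 int_a^t f,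
    and summing its increments over the three pieces gives the identity
    (kernel_primitive_identity).  Hoelder's inequality is then needed only for
    increments of primitives (norm_increment_holder): if g' is bounded by x y
    with x^p <= U' and y^q <= V', Young's inequality with scale factors r and s
    bounds |g'| by the derivative of a combination of U and V, monotonicity
    transfers this to increments, and optimising r and s yields
    (U(d) - U(c))^(1/p) (V(d) - V(c))^(1/q).  Here U is the primitive of
    |t - m|^(2p) (is_derive_abs_moment) and V the primitive of the chord
    (norm_kernel_increment_le). *)

(** * Derivatives relative to a set *)

Lemma derivable_within_cvg (R : realType) (A : set R) (f : R -> R) (x : R) :
  derivable_within A f x -> f y @[y --> within A (nbhs x)] --> f x.
Proof.
move=> /cvg_ex[l fl].
have idx : y @[y --> within A x^'] --> x.
  by apply: cvg_trans (cvg_within_filter _ _) _ => //; exact: cvg_within.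
have : f x + ((f y - f x) / (y - x)) * (y - x) @[y --> within A x^']
    --> f x + l * (x - x).
  apply: cvgD; first exact: cvg_cst.
  by apply: cvgM => //; apply: cvgB => //; exact: cvg_cst.
rewrite subrr mulr0 addr0 => /cvgrPdist_lt h; apply/cvgrPdist_lt => e e0.
have := h _ e0; rewrite !near_withinE /dnbhs /within/=.
apply: filterS => y hy Ay; have [->|yx] := eqVneq y x; first by rewrite subrr normr0.
by have := hy yx Ay; rewrite divfK ?subr_eq0// addrCA subrr addr0.
Qed.

Lemma derivable_within_continuous_on (R : realType) (A : set R) (f : R -> R) :
  (forall x, A x -> derivable_within A f x) -> {within A, continuous f}.
Proof.
by move=> df; apply/subspace_continuousP => x /df/derivable_within_cvg.
Qed.

(** Near an interior point the restriction to [A] is void, so the relative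
    difference quotient is the ordinary one after the shift y = x + h. *)
Lemma is_derive_within (R : realType) (A : set R) (f : R -> R) (x : R) :
  nbhs x A -> derivable_within A f x -> is_derive x 1 f (derive_within A f x).
Proof.
move=> xA dfx; set l := derive_within A f x.
suff dl : (fun h => h^-1 *: ((f \o shift x) (h *: (1 : R)) - f x)) @ 0^' --> l.
  by apply: DeriveDef; [exact: cvgP dl|exact: cvg_lim dl].
apply/cvgrPdist_lt => e e0.
move/cvgrPdist_lt : dfx => /(_ _ e0).
rewrite !near_withinE /dnbhs /within/= => /filterI/(_ xA)/nbhs0P.
apply: filterS => h [hl Ah] h0; move: hl.
rewrite (addrC x) addrK -subr_eq0 addrK => /(_ h0).
rewrite (addrC h) => /(_ Ah).
by rewrite /= /GRing.scale/= mulr1 (addrC h) (mulrC h^-1).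
Qed.

(** * Differential form of Hoelder's inequality *)

Lemma powRV (R : realType) (z e : R) : 0 <= z -> z^-1 `^ e = (z `^ e)^-1.
Proof. by move=> z0; rewrite -powR_inv1// -powRrM mulN1r powRN. Qed.

Lemma le_increment (R : realType) (c d : R) (g G g' G' : R -> R) : c <= d ->
  {within `[c, d], continuous g} -> {within `[c, d], continuous G} ->
  (forall t, t \in `]c, d[ -> is_derive t 1 g (g' t)) ->
  (forall t, t \in `]c, d[ -> is_derive t 1 G (G' t)) ->
  (forall t, t \in `]c, d[ -> g' t <= G' t) ->
  g d - g c <= G d - G c.
Proof.
move=> cd cg cG dg dG gG.
have dGg t : t \in `]c, d[ -> is_derive t 1 (G - g) (G' t - g' t).
  by move=> tcd; apply: is_deriveB; [exact: dG|exact: dg].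
have cGg : {within `[c, d], continuous (G - g)}.
  by move=> t; apply: cvgB; [exact: cG|exact: cg].
have := @ger0_derive1_le_cc _ (G - g) c d _ _ cGg c d.
rewrite !in_itv/= !lexx cd/= => h.
have {}h : G c - g c <= G d - g d.
  apply: h => // t tcd.
    by have [] := dGg t tcd.
  by rewrite derive1E (@derive_val _ _ _ _ _ _ _ (dGg t tcd)) subr_ge0 gG.
lra.
Qed.

Lemma norm_le_increment (R : realType) (c d : R) (g G g' G' : R -> R) : c <= d ->
  {within `[c, d], continuous g} -> {within `[c, d], continuous G} ->
  (forall t, t \in `]c, d[ -> is_derive t 1 g (g' t)) ->
  (forall t, t \in `]c, d[ -> is_derive t 1 G (G' t)) ->
  (forall t, t \in `]c, d[ -> `|g' t| <= G' t) ->
  `|g d - g c| <= G d - G c.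
Proof.
move=> cd cg cG dg dG gG; rewrite ler_norml; apply/andP; split; last first.
  apply: (le_increment cd cg cG dg dG) => t /gG; exact: le_trans (ler_norm _).
have := @le_increment _ c d (- g) G (fun t => - g' t) G' cd _ cG _ dG.
rewrite !fctE; rewrite -opprD lerNl; apply.
- by move=> t; apply: cvgN; exact: cg.
- by move=> t tcd; apply: is_deriveN; exact: dg.
- by move=> t /gG; apply: le_trans; rewrite -normrN ler_norm.
Qed.

(** The right-hand side of the hypothesis is Young's bound after the rescaling
    x y = r s (x / r) (y / s).  For X, Y > 0 it is optimal at r = X^(1/p) and
    s = Y^(1/q), where the bracket is 1/p + 1/q = 1; if X vanishes it
    tends to 0 with r, and if Y vanishes it tends to 0 with s. *)
Lemma le_prod_powR_of_scaled (R : realType) (p q X Y Z : R) :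
  0 < p -> 0 < q -> p^-1 + q^-1 = 1 -> 0 <= X -> 0 <= Y ->
  (forall r s : R, 0 < r -> 0 < s ->
     Z <= r * s * (X / (p * r `^ p) + Y / (q * s `^ q))) ->
  Z <= X `^ p^-1 * Y `^ q^-1.
Proof.
move=> p0 q0 pq.
have pos (u : R) : 0 < u -> u != 0 by move/lt0r_neq0.
have degenerate (p' X' : R) : 0 < p' -> 0 <= X' ->
    (forall s : R, 0 < s -> Z <= s * (X' / p')) -> Z <= 0.
  move=> p'0 X'0 h; apply/ler_addgt0Pr => e e0; rewrite add0r.
  (* The denominator X' + 1, rather than X', allows X' = 0. *)
  apply: (le_trans (h (e * p' / (X' + 1)) _)).
    by rewrite divr_gt0 ?mulr_gt0// ltr_wpDl.
  have -> : e * p' / (X' + 1) * (X' / p') = e * (X' / (X' + 1)).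
    by field; rewrite !pos// ltr_wpDl.
  by rewrite ler_piMr ?(ltW e0)// ler_pdivrMr ?ltr_wpDl// mul1r lerDl.
rewrite le_eqVlt => /predU1P[<- Y0 h|X0].
  rewrite powR0 ?mul0r ?invr_eq0 ?pos//.
  apply: (degenerate q Y q0 Y0) => s s0.
  by have := h s 1 s0 ltr01; rewrite mul0r add0r powR1 !mulr1.
rewrite le_eqVlt => /predU1P[<- h|Y0 h].
  rewrite powR0 ?mulr0 ?invr_eq0 ?pos//.
  apply: (degenerate p X p0 (ltW X0)) => s s0.
  by have := h 1 s ltr01 s0; rewrite mul0r addr0 powR1 mulr1 mul1r.
apply: le_trans (h _ _ (powR_gt0 p^-1 X0) (powR_gt0 q^-1 Y0)) _.
rewrite -!powRrM !mulVf ?pos// (powRr1 (ltW X0)) (powRr1 (ltW Y0)).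
rewrite [X in _ * X](_ : _ = 1) ?mulr1//.
by rewrite -pq; field; rewrite !pos.
Qed.

(** Hoelder's inequality with each integral read as the increment of a
    primitive: a pointwise bound between derivatives passes to increments by
    monotonicity, so that Young's inequality can be applied pointwise and the
    scale factors optimised afterwards. *)
Lemma norm_increment_holder (R : realType) (p q c d : R)
    (g U V g' u v : R -> R) :
  0 < p -> 0 < q -> p^-1 + q^-1 = 1 -> c <= d ->
  {within `[c, d], continuous g} -> {within `[c, d], continuous U} ->
  {within `[c, d], continuous V} ->
  (forall t, t \in `]c, d[ -> is_derive t 1 g (g' t)) ->
  (forall t, t \in `]c, d[ -> is_derive t 1 U (u t)) ->
  (forall t, t \in `]c, d[ -> is_derive t 1 V (v t)) ->
  (forall t, t \in `]c, d[ -> exists x y : R, [/\ 0 <= x, 0 <= y,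
     `|g' t| <= x * y, x `^ p <= u t & y `^ q <= v t]) ->
  `|g d - g c| <= (U d - U c) `^ p^-1 * (V d - V c) `^ q^-1.
Proof.
move=> p0 q0 pq cd cg cU cV dg dU dV H.
have pos (w : R) : 0 < w -> w != 0 by move/lt0r_neq0.
have d0 t : t \in `]c, d[ -> is_derive t 1 (cst 0 : R -> R) 0.
  by move=> _; exact: is_derive_cst.
have c0 : {within `[c, d], continuous (cst 0 : R -> R)}.
  by move=> t; exact: cvg_cst.
apply: le_prod_powR_of_scaled => //.
- have := le_increment cd c0 cU d0 dU; rewrite subrr; apply.
  by move=> t /H[x [y [x0 y0 _ xu yv]]]; rewrite (le_trans _ xu)// powR_ge0.
- have := le_increment cd c0 cV d0 dV; rewrite subrr; apply.
  by move=> t /H[x [y [x0 y0 _ xu yv]]]; rewrite (le_trans _ yv)// powR_ge0.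
move=> r s r0 s0.
have rp0 : 0 < r `^ p by rewrite powR_gt0.
have sq0 : 0 < s `^ q by rewrite powR_gt0.
pose k := r * s / (p * r `^ p); pose l := r * s / (q * s `^ q).
have k0 : 0 <= k by rewrite divr_ge0 ?mulr_ge0 ?ltW.
have l0 : 0 <= l by rewrite divr_ge0 ?mulr_ge0 ?ltW.
pose W : R -> R := k \*: U + l \*: V.
have cW : {within `[c, d], continuous W}.
  by move=> t; apply: cvgD; apply: cvgZr; [exact: cU|exact: cV].
have dW t : t \in `]c, d[ -> is_derive t 1 W (k * u t + l * v t).
  by move=> tcd; apply: is_deriveD; apply: is_deriveZ; [exact: dU|exact: dV].
have -> : r * s * ((U d - U c) / (p * r `^ p) + (V d - V c) / (q * s `^ q)) =
    W d - W c.
  have WE t : W t = k * U t + l * V t by [].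
  by rewrite !WE /k /l; ring.
apply: (norm_le_increment cd cg cW dg dW) => t /H[x [y [x0 y0 gxy xu yv]]].
apply: (le_trans gxy).
have xr : 0 <= x / r by rewrite divr_ge0// ltW.
have ys : 0 <= y / s by rewrite divr_ge0// ltW.
have rs : 0 <= r * s by rewrite mulr_ge0// ltW.
have young := ler_wpM2l rs (conjugate_powR xr ys p0 q0 pq).
have powR_div (w z e : R) : 0 <= w -> 0 < z -> (w / z) `^ e = w `^ e / z `^ e.
  by move=> w0 z0; rewrite powRM ?invr_ge0 ?(ltW z0)// powRV ?(ltW z0).
rewrite !powR_div// in young.
have xyE : r * s * (x / r * (y / s)) = x * y by field; rewrite !pos.
rewrite xyE in young; apply: (le_trans young).
have -> : r * s * (x `^ p / r `^ p / p + y `^ q / s `^ q / q) =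
  k * x `^ p + l * y `^ q by rewrite /k /l; field; rewrite !pos.
by rewrite lerD// ler_wpM2l.
Qed.

(** * The two Hoelder factors on one piece *)

(** Up to the factor 2 p + 1, the primitive of |t - m|^(2p) that vanishes
    at [m]; writing |t - m|^(2p) as ((t - m)^2)^p gives one formula on both
    sides of [m]. *)
Definition abs_moment_primitive (R : realType) (p m t : R) : R :=
  (t - m) * ((t - m) ^+ 2) `^ p.

(** At t = m the chain rule fails, because powers are differentiable only at
    positive bases; there the difference quotient (h^2)^p is at most |h| for
    small h. *)
Lemma is_derive_abs_moment (R : realType) (p m t : R) : 1 <= p ->
  is_derive t 1 (abs_moment_primitive p m) ((2 * p + 1) * ((t - m) ^+ 2) `^ p).
Proof.
move=> p1; have [->|tm] := eqVneq t m.
  have p0 : p != 0 by rewrite gt_eqF// (lt_le_trans ltr01).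
  rewrite subrr expr0n/= powR0// mulr0.
  suff h0 : (fun h => h^-1 *: ((abs_moment_primitive p m \o shift m) (h *: (1 : R))
      - abs_moment_primitive p m m)) @ 0^' --> (0 : R).
    by apply: DeriveDef; [exact: cvgP h0|exact: cvg_lim h0].
  apply: (@cvg_to_0_linear _ _ 1 1) => // h /andP[h0 h1]; rewrite /abs_moment_primitive/=.
  rewrite subrr mul0r subr0 addrK.
  have -> : h%:A = h by rewrite /GRing.scale/= mulr1.
  rewrite /GRing.scale/= mulKf -?normr_gt0// mul1r.
  rewrite ger0_norm ?powR_ge0//.
  have hh : `|h| ^+ 2 <= `|h| by rewrite expr2 ler_piMl// ltW.
  rewrite -real_normK ?num_real// (le_trans _ hh)//.
  by rewrite ge1r_powR// exprn_gt0//= (le_trans hh)// ltW.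
have s0 : 0 < (t - m) ^+ 2 by rewrite exprn_even_gt0//= subr_eq0.
have d1 : is_derive t 1 (fun s : R => (s - m)) 1.
  by apply: is_derive_eq; rewrite subr0.
have d2 : is_derive t 1 (fun s : R => (s - m) ^+ 2) (2 * (t - m)).
  by apply: is_derive_eq; rewrite /GRing.scale/=; ring.
have d3 := @is_derive1_comp R (fun s => s `^ p) (fun s => (s - m) ^+ 2) t _ _
  (is_derive1_powR p s0) d2.
have d4 := is_deriveM d1 d3.
apply: (is_derive_eq d4).
rewrite /GRing.scale/= mulr1.
have /= <- := mulr_powRB1 (ltW s0) (lt_le_trans ltr01 p1).
by ring.
Qed.

Lemma convex_function_le_chord (R : realType) (a b c d t : R) (h : R -> R) :
  convex_function (`[a, b]%classic : set R^o) h ->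
  a <= c -> c < d -> d <= b -> t \in `[c, d] ->
  h t <= (h c * (d - t) + h d * (t - c)) / (d - c).
Proof.
move=> hcvx ac cd db; rewrite in_itv/= => /andP[ct td].
have dc0 : 0 < d - c by rewrite subr_gt0.
have s01 : 0 <= (d - t) / (d - c) <= 1.
  by rewrite divr_ge0 ?subr_ge0 ?(ltW cd)//= ler_pdivrMr// mul1r lerD2l lerN2.
pose s : {i01 R} := Itv01 (andP s01).1 (andP s01).2.
have abc : (c : R^o) \in (`[a, b]%classic : set R^o).
  by rewrite inE/= in_itv/= ac (le_trans (ltW cd)).
have abd : (d : R^o) \in (`[a, b]%classic : set R^o).
  by rewrite inE/= in_itv/= db (le_trans ac (ltW cd)).
have dc_neq0 : d - c != 0 by rewrite gt_eqF.
pose r := (d - t) / (d - c).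
have tE : r * c + (1 - r) * d = t by rewrite /r; field.
have /= : h (r * c + (1 - r) * d) <= r * h c + (1 - r) * h d := hcvx s c d abc abd.
rewrite tE => /le_trans; apply; rewrite le_eqVlt; apply/orP; left; apply/eqP.
by rewrite /r; field.
Qed.

(** The Hoelder factors multiplied out: the exponents 1/p of k h / (2 p + 1)
    and 1/q of k h S / 2 recombine since 1/p + 1/q = 1. The factor [k] is 1
    when the kernel is centred at an endpoint of the piece and 2 when it is
    centred at the midpoint, [h] being the largest distance to the centre. *)
Lemma holder_bound_power_chord (R : realType) (p q k h S : R) :
  0 < p -> 0 < q -> p^-1 + q^-1 = 1 -> 0 <= k -> 0 <= h -> 0 <= S ->
  (k * h * (h ^+ 2) `^ p / (2 * p + 1)) `^ p^-1 * (k * h * (S / 2)) `^ q^-1 =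
  k * h ^+ 3 * S `^ q^-1 / ((2 * p + 1) `^ p^-1 * 2 `^ q^-1).
Proof.
move=> p0 q0 pq k0 h0 S0.
have p21 : 0 < 2 * p + 1 by rewrite addr_gt0 ?mulr_gt0.
have kh0 : 0 <= k * h by rewrite mulr_ge0.
rewrite !powRM ?mulr_ge0 ?divr_ge0 ?invr_ge0 ?powR_ge0 ?(ltW p21)//.
rewrite !powRV ?(ltW p21)// -powRrM mulfV ?gt_eqF// powRr1 ?exprn_ge0//.
have khE : k * h = (k `^ p^-1 * h `^ p^-1) * (k `^ q^-1 * h `^ q^-1).
  rewrite -!powRM// -powRD ?pq ?powRr1//.
  by apply/implyP; rewrite oner_eq0.
rewrite (_ : k * h ^+ 3 = k * h * h ^+ 2); last by ring.
rewrite khE; field.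
by rewrite !gt_eqF ?powR_gt0.
Qed.

(** * The primitive of the kernel times the second derivative *)

(** For F a primitive of f, this is the primitive of (t - m)^2 f''(t) obtained
    by two integrations by parts. *)
Definition kernel_primitive (R : realType) (F f f' : R -> R) (m t : R) : R :=
  (t - m) ^+ 2 * f' t - 2 * (t - m) * f t + 2 * F t.

Lemma is_derive_kernel_primitive (R : realType) (F f f' f'' : R -> R) (m t : R) :
  is_derive t 1 F (f t) -> is_derive t 1 f (f' t) -> is_derive t 1 f' (f'' t) ->
  is_derive t 1 (kernel_primitive F f f' m) ((t - m) ^+ 2 * f'' t).
Proof.
move=> dF df df'.
have d1 : is_derive t 1 (fun s : R => s - m) 1.
  by apply: is_derive_eq; rewrite subr0.
have d2 : is_derive t 1 (fun s : R => (s - m) ^+ 2) (2 * (t - m)).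
  by apply: is_derive_eq; rewrite /GRing.scale/=; ring.
have d3 : is_derive t 1 (fun s : R => 2 * (s - m)) 2.
  by apply: is_derive_eq; rewrite /GRing.scale/=; ring.
have d := is_deriveD (is_deriveB (is_deriveM d2 df') (is_deriveM d3 df))
  (is_deriveZ 2 dF).
by apply: (is_derive_eq d); rewrite /GRing.scale/=; ring.
Qed.

Lemma continuous_kernel_primitive (R : realType) (A : set R) (F f f' : R -> R)
    (m : R) :
  {within A, continuous F} -> {within A, continuous f} ->
  {within A, continuous f'} ->
  {within A, continuous (kernel_primitive F f f' m)}.
Proof.
move=> cF cf cf'.
have csub : {within A, continuous (fun s : R => s - m)}.
  apply: continuous_subspaceT => s.
  by apply: cvgB => //; exact: cvg_cst.
move=> t.
apply: cvgD; last by apply: cvgM; [exact: cvg_cst|exact: cF].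
apply: cvgB; apply: cvgM; [|exact: cf'| |exact: cf].
- by apply: cvgM; exact: csub.
- by apply: cvgM; [exact: cvg_cst|exact: csub].
Qed.

(** Hoelder's inequality for (t - m)^2 |f''(t)| on [c, d], the q-th power of
    |f''| being replaced by its chord. *)
Lemma norm_kernel_increment_le (R : realType) (F f f' f'' : R -> R)
    (p q a b c d m : R) :
  1 <= p -> 0 < q -> p^-1 + q^-1 = 1 -> a <= c -> c <= d -> d <= b ->
  {within `[a, b], continuous F} -> {within `[a, b], continuous f} ->
  {within `[a, b], continuous f'} ->
  (forall t, t \in `]a, b[ -> is_derive t 1 F (f t)) ->
  (forall t, t \in `]a, b[ -> is_derive t 1 f (f' t)) ->
  (forall t, t \in `]a, b[ -> is_derive t 1 f' (f'' t)) ->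
  convex_function (`[a, b]%classic : set R^o) (fun t => `|f'' t| `^ q) ->
  `|kernel_primitive F f f' m d - kernel_primitive F f f' m c| <=
  ((abs_moment_primitive p m d - abs_moment_primitive p m c) / (2 * p + 1)) `^ p^-1 *
  ((d - c) * ((`|f'' c| `^ q + `|f'' d| `^ q) / 2)) `^ q^-1.
Proof.
move=> p1 q0 pq ac; rewrite le_eqVlt => /predU1P[<- _ _ _ _ _ _ _ _|cd db].
  by rewrite subrr normr0 mulr_ge0 ?powR_ge0.
move=> cF cf cf' dF df df' cvx.
have p0 : 0 < p := lt_le_trans ltr01 p1.
have p21 : 2 * p + 1 != 0 by rewrite gt_eqF// addr_gt0 ?mulr_gt0.
have dc0 : d - c != 0 by rewrite subr_eq0 gt_eqF.
have sub_cc : `[c, d] `<=` `[a, b].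
  by move=> t /=; rewrite !in_itv/= => /andP[? ?]; apply/andP; split; lra.
have sub_oo t : t \in `]c, d[ -> t \in `]a, b[.
  by rewrite !in_itv/= => /andP[? ?]; apply/andP; split; lra.
pose A := `|f'' c| `^ q; pose B := `|f'' d| `^ q.
pose U (t : R) : R := (2 * p + 1)^-1 * abs_moment_primitive p m t.
(* The primitive of the chord whose increment over [c, d] is visibly the
   trapezoidal area. *)
pose V (t : R) : R := (2 * (d - c))^-1 * (B * (t - c) ^+ 2 - A * (d - t) ^+ 2).
have -> : (abs_moment_primitive p m d - abs_moment_primitive p m c) / (2 * p + 1) =
  U d - U c by rewrite /U -mulrBr mulrC.
have -> : (d - c) * ((A + B) / 2) = V d - V c.
  by rewrite /V; field.
have dU (t : R) : is_derive t 1 U (((t - m) ^+ 2) `^ p).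
  have dM := is_deriveZ (2 * p + 1)^-1 (is_derive_abs_moment m t p1).
  by apply: (is_derive_eq dM); rewrite /GRing.scale/= mulKf.
have dV (t : R) : is_derive t 1 V ((A * (d - t) + B * (t - c)) / (d - c)).
  by rewrite /V; apply: is_derive_eq; rewrite /GRing.scale/=; field.
have cU : {within `[c, d], continuous U}.
  apply: continuous_subspaceT => t.
  by apply/differentiable_continuous/derivable1_diffP; have [] := dU t.
have cV : {within `[c, d], continuous V}.
  apply: continuous_subspaceT => t.
  by apply/differentiable_continuous/derivable1_diffP; have [] := dV t.
have cg : {within `[c, d], continuous (kernel_primitive F f f' m)}.
  apply: (continuous_subspaceW sub_cc).
  exact: continuous_kernel_primitive.
have dg t : t \in `]c, d[ ->
    is_derive t 1 (kernel_primitive F f f' m) ((t - m) ^+ 2 * f'' t).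
  move=> /sub_oo tab.
  by apply: is_derive_kernel_primitive; [exact: dF|exact: df|exact: df'].
have holder := norm_increment_holder p0 q0 pq (ltW cd) cg cU cV dg
  (fun t _ => dU t) (fun t _ => dV t).
apply: holder => t tcd; exists ((t - m) ^+ 2), `|f'' t|; split => //.
- exact: sqr_ge0.
- by rewrite normrM ger0_norm ?sqr_ge0.
- exact: (convex_function_le_chord cvx ac cd db (subset_itv_oo_cc tcd)).
Qed.

(** * The inequality *)

(** The terms in f and f' at [x] and [y] are the jumps of the kernel and of
    its derivative there; at the endpoints the kernel and its derivative
    vanish, so no boundary terms remain. *)
Lemma kernel_primitive_identity (R : realType) (F f f' : R -> R) (a b x : R) :
  a < b -> F a = 0 ->
  let y := a + b - x in
  1 / (b - a) * F b - 1 / 2 * (f x + f y)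
    + 1 / 2 * (x - (3 * a + b) / 4) * (f' x - f' y) =
  (2 * (b - a))^-1 *
  ((kernel_primitive F f f' a x - kernel_primitive F f f' a a)
   + (kernel_primitive F f f' ((a + b) / 2) y
      - kernel_primitive F f f' ((a + b) / 2) x)
   + (kernel_primitive F f f' b b - kernel_primitive F f f' b y)).
Proof.
move=> ab Fa y; rewrite /kernel_primitive Fa.
move: (f x) (f y) (f a) (f b) (f' x) (f' y) (f' a) (f' b) (F x) (F y) (F b).
rewrite /y => *; field.
by rewrite subr_eq0 gt_eqF.
Qed.

Theorem theorem4 (R : realType) (a b : R) (f : R -> R) (p q : R) :
  let f' := derive_within `[a, b] f in
  let f'' := derive_within `[a, b] f' in
  a < b ->
  {in `[a, b], forall x, derivable_within `[a, b] f x} ->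
  absolutely_continuous a b f' ->
  {in `[a, b], forall x, derivable_within `[a, b] f' x} ->
  lebesgue_measure.-integrable `[a, b] (EFin \o f'') ->
  1 < q ->
  1 / p + 1 / q = 1 ->
  convex_function (`[a, b]%classic : set R^o) (fun x => `|f'' x| `^ q) ->
  forall x : R, x \in `[a, (a + b) / 2] ->
  `| 1 / (b - a) * (\int[lebesgue_measure]_(t in `[a, b]) f t)
     - 1 / 2 * (f x + f (a + b - x))
     + 1 / 2 * (x - (3 * a + b) / 4) * (f' x - f' (a + b - x)) |
  <= 1 / (2 `^ (1 + 1 / q) * (b - a) * (2 * p + 1) `^ (1 / p)) *
     ( (x - a) ^+ 3 * (`|f'' a| `^ q + `|f'' x| `^ q) `^ (1 / q)
     + (a + b - 2 * x) ^+ 3 / 4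
         * (`|f'' x| `^ q + `|f'' (a + b - x)| `^ q) `^ (1 / q)
     + (x - a) ^+ 3
         * (`|f'' (a + b - x)| `^ q + `|f'' b| `^ q) `^ (1 / q) ).
Proof.
move=> f' f'' ab df _ df' _ q1; rewrite !div1r => pq cvx x.
rewrite in_itv/= => /andP[ax xm].
have q0 : 0 < q := lt_trans ltr01 q1.
have ip0 : 0 < p^-1.
  by rewrite -(ltrD2r q^-1) add0r pq invf_lt1.
have p0 : 0 < p by rewrite -invr_gt0.
have p1 : 1 <= p.
  by rewrite -(invrK p) invf_ge1// -pq lerDl invr_ge0 ltW.
pose F t := \int[lebesgue_measure]_(s in `[a, t]) f s.
have cf : {within `[a, b], continuous f}.
  by apply: derivable_within_continuous_on => t tab; apply: df.
have cf' : {within `[a, b], continuous f'}.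
  by apply: derivable_within_continuous_on => t tab; apply: df'.
have intf : lebesgue_measure.-integrable `[a, b] (EFin \o f).
  by apply: continuous_compact_integrable => //; exact: segment_compact.
have cF : {within `[a, b], continuous F}.
  exact: parameterized_integral_continuous (ltW ab) intf.
have Fa : F a = 0 by rewrite /F set_itv1 Rintegral_set1.
have dF t : t \in `]a, b[ -> is_derive t 1 F (f t).
  move=> tab; have := tab; rewrite in_itv/= => /andP[a_t tb].
  have [dFt Ft] := continuous_FTC1_closed tb intf a_t
    (within_continuous_continuous ab cf tab).
  by apply: DeriveDef; [exact: dFt|rewrite -derive1E; exact: Ft].
have nbhs_ab t : t \in `]a, b[ -> nbhs t `[a, b]%classic.
  by move=> tab; apply: filterS (near_in_itvoo tab) => s; exact: subset_itv_oo_cc.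
have dfo t : t \in `]a, b[ -> is_derive t 1 f (f' t).
  by move=> tab; apply: is_derive_within; [exact: nbhs_ab|apply: df;
    exact: subset_itv_oo_cc].
have dfo' t : t \in `]a, b[ -> is_derive t 1 f' (f'' t).
  by move=> tab; apply: is_derive_within; [exact: nbhs_ab|apply: df';
    exact: subset_itv_oo_cc].
have := kernel_primitive_identity f f' x ab Fa; rewrite !div1r /= => ->.
set y := a + b - x.
have xy : x <= y by rewrite /y; lra.
have ay : a <= y by rewrite /y; lra.
have yb : y <= b by rewrite /y; lra.
have xb : x <= b by lra.
(* Largest distance to the centre of the kernel: h on the outer pieces, k on
   the middle one. *)
pose h := x - a; pose k := (a + b - 2 * x) / 2.
have h0 : 0 <= h by rewrite subr_ge0.
have k0 : 0 <= k by rewrite /k; lra.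
have bound c d m : a <= c -> c <= d -> d <= b -> _ :=
  fun ac cd db => @norm_kernel_increment_le R F f f' f'' p q a b c d m
    p1 q0 pq ac cd db cF cf cf' dF dfo dfo' cvx.
pose S c d := `|f'' c| `^ q + `|f'' d| `^ q.
have S0 c d : 0 <= S c d by rewrite addr_ge0 ?powR_ge0.
pose C := (2 * p + 1) `^ p^-1 * 2 `^ q^-1.
have bound1 : `|kernel_primitive F f f' a x - kernel_primitive F f f' a a| <=
    1 * h ^+ 3 * S a x `^ q^-1 / C.
  rewrite -(holder_bound_power_chord p0 q0 pq)//.
  have := bound a x a (lexx a) ax xb.
  by rewrite /abs_moment_primitive subrr mul0r subr0 mul1r.
have bound2 : `|kernel_primitive F f f' ((a + b) / 2) y
      - kernel_primitive F f f' ((a + b) / 2) x| <=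
    2 * k ^+ 3 * S x y `^ q^-1 / C.
  rewrite -(holder_bound_power_chord p0 q0 pq)//.
  have := bound x y ((a + b) / 2) ax xy yb.
  rewrite /abs_moment_primitive.
  have -> : y - (a + b) / 2 = k by rewrite /y /k; field.
  have -> : x - (a + b) / 2 = - k by rewrite /k; field.
  have -> : y - x = 2 * k by rewrite /y /k; field.
  rewrite sqrrN.
  have -> : k * (k ^+ 2) `^ p - - k * (k ^+ 2) `^ p = 2 * k * (k ^+ 2) `^ p.
    by ring.
  by [].
have bound3 : `|kernel_primitive F f f' b b - kernel_primitive F f f' b y| <=
    1 * h ^+ 3 * S y b `^ q^-1 / C.
  rewrite -(holder_bound_power_chord p0 q0 pq)//.
  have := bound y b b ay yb (lexx b).
  rewrite /abs_moment_primitive subrr mul0r.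
  have -> : y - b = - h by rewrite /y /h; ring.
  have -> : b - y = h by rewrite /y /h; ring.
  by rewrite sqrrN mulNr sub0r opprK mul1r.
have ba0 : 0 < 2 * (b - a) by rewrite mulr_gt0 ?subr_gt0.
rewrite normrM (gtr0_norm (_ : 0 < (2 * (b - a))^-1)) ?invr_gt0//.
rewrite mulrC ler_pdivrMr//.
apply: le_trans (ler_normD _ _) _; apply: le_trans (lerD (ler_normD _ _) (lexx _)) _.
apply: le_trans (lerD (lerD bound1 bound2) bound3) _.
have two_powE : (2 : R) `^ (1 + q^-1) = 2 * 2 `^ q^-1.
  have two_unit : (1 + q^-1 == 0) ==> ((2 : R) != 0) by apply/implyP.
  by rewrite (powRD two_unit) powRr1.
have cp : (2 * p + 1) `^ p^-1 != 0.
  by rewrite gt_eqF// powR_gt0// addr_gt0 ?mulr_gt0.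
have cq : (2 : R) `^ q^-1 != 0 by rewrite gt_eqF ?powR_gt0.
have sumE (cp' cq' s1 s2 s3 : R) : cp' != 0 -> cq' != 0 ->
    1 * h ^+ 3 * s1 / (cp' * cq') + 2 * k ^+ 3 * s2 / (cp' * cq')
      + 1 * h ^+ 3 * s3 / (cp' * cq') =
    (2 * cq' * (b - a) * cp')^-1 *
    ((x - a) ^+ 3 * s1 + (a + b - 2 * x) ^+ 3 / 4 * s2 + (x - a) ^+ 3 * s3) *
    (2 * (b - a)).
  move=> cp'0 cq'0; rewrite /h /k; field.
  by rewrite cp'0 cq'0 subr_eq0 gt_eqF.
by rewrite two_powE (sumE _ _ _ _ _ cp cq) lexx.
Qed.
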